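(* Let $m\ge 1$ and $s\ge 2$ be integers. If $G_v(s)$ is the graph obtained from $mC_6$ by attaching $s$ pendant edges to a single vertex of $mC_6$, then $\chi_{lt}(G_v(s))=\Delta(G_v(s))+1=s+3$.
   Context: $mC_6$ is the disjoint union of $m$ copies of the cycle $C_6$ on 6 vertices. Attaching $s$ pendant edges to a vertex $v$ means adding $s$ new vertices, each joined only to $v$. $\Delta(G)$ is the maximum degree. For a finite simple graph $G=(V,E)$ of order $p$ and size $q$, a local total antimagic labeling is a bijection $f:V\cup E\to\{1,\dots,p+q\}$ such that, with weights $w_f(u)=\sum f(e)$ over all edges $e$ incident to $u$ for $u\in V$ (the label of $u$ itself is not included) and $w_f(uv)=f(u)+f(v)$ for $uv\in E$, one has: adjacent vertices have distinct weights, adjacent edges have distinct weights, and every vertex has a weight distinct from that of each of its incident edges. $\chi_{lt}(G)$ is the minimum, over all local total antimagic labelings $f$ of $G$, of the number of distinct values among all the vertex and edge weights. *)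

(* Defs.v *)
From mathcomp Require Import all_boot.

Set Implicit Arguments.
Unset Strict Implicit.
Unset Printing Implicit Defensive.

Record sgraph := SGraph {
  vertex :> finType;
  adj : rel vertex;
  adj_sym : symmetric adj;
  adj_irr : irreflexive adj
}.

Definition edges (G : sgraph) : {set {set G}} :=
  [set A : {set G} | [exists x, exists y, adj x y && (A == [set x; y])]].

Notation edge G := {A : {set vertex G} | A \in edges G}.

Definition degree (G : sgraph) (u : G) : nat := #|[set x | adj u x]|.

Definition max_degree (G : sgraph) : nat := \max_(u : G) degree u.

Section Labeling.

Variables (G : sgraph) (f : G + edge G -> nat).

Definition vertex_weight (u : G) : nat := \sum_(e : edge G | u \in val e) f (inr e).

Definition edge_weight (e : edge G) : nat := \sum_(u in val e) f (inl u).

Definition weight (x : G + edge G) : nat :=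
  match x with inl u => vertex_weight u | inr e => edge_weight e end.

Definition total_labeling : Prop :=
  injective f /\
  forall k : nat, (exists x, f x = k) <-> (1 <= k <= #|G| + #|edges G|).

Definition local_total_antimagic : Prop :=
  [/\ total_labeling,
      forall u v : G, adj u v -> vertex_weight u <> vertex_weight v,
      forall e e' : edge G, e <> e' -> val e :&: val e' != set0 ->
        edge_weight e <> edge_weight e'
    & forall (u : G) (e : edge G), u \in val e ->
        vertex_weight u <> edge_weight e].

Definition num_weights : nat := size (undup (codom weight)).

End Labeling.

(* A relation rather than a function: the minimum is over labelings that need
   not exist (e.g. for K_2), and then no [k] is related to [G]. *)
Definition is_chi_lt (G : sgraph) (k : nat) : Prop :=
  (exists f : G + edge G -> nat, local_total_antimagic f /\ num_weights f = k) /\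
  (forall f : G + edge G -> nat, local_total_antimagic f -> k <= num_weights f).

(* [ordS] is the cyclic successor on ['I_6]. *)
Definition C6_adj : rel 'I_6 := fun i j => (j == ordS i) || (i == ordS j).

Fact C6_adj_sym : symmetric C6_adj.
Proof. by move=> i j; rewrite /C6_adj orbC. Qed.

Fact C6_adj_irr : irreflexive C6_adj.
Proof. by case=> [[|[|[|[|[|[|k]]]]]] hk]. Qed.

Definition C6 : sgraph := SGraph C6_adj_sym C6_adj_irr.

Section Copies.

Variables (m : nat) (G : sgraph).

Definition copies_adj : rel ('I_m * G)%type :=
  fun x y => (x.1 == y.1) && adj x.2 y.2.

Fact copies_adj_sym : symmetric copies_adj.
Proof. by move=> x y; rewrite /copies_adj eq_sym adj_sym. Qed.

Fact copies_adj_irr : irreflexive copies_adj.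
Proof. by move=> x; rewrite /copies_adj adj_irr andbF. Qed.

Definition copies : sgraph := SGraph copies_adj_sym copies_adj_irr.

End Copies.

Section Pendants.

Variables (G : sgraph) (v : G) (s : nat).

Definition pendants_adj : rel (G + 'I_s)%type := fun x y =>
  match x, y with
  | inl a, inl b => adj a b
  | inl a, inr _ => a == v
  | inr _, inl b => b == v
  | inr _, inr _ => false
  end.

Fact pendants_adj_sym : symmetric pendants_adj.
Proof. by move=> [a|i] [b|j] //=; rewrite adj_sym. Qed.

Fact pendants_adj_irr : irreflexive pendants_adj.
Proof. by move=> [a|i] //=; rewrite adj_irr. Qed.

Definition attach_pendants : sgraph := SGraph pendants_adj_sym pendants_adj_irr.

End Pendants.

(* Main.v *)
(** The vertex [v] and the [s + 2] edges at it are pairwise adjacent or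
    incident, so any labeling has at least [s + 3] weights.

    For the converse put [N = 12m + 2s].  The labels [s + 1 .. s + 12m] are cut
    into triples of consecutive integers; each triple together with its mirror
    image [x |-> N + 1 - x] fills the six vertices, or the six edges, of one
    cycle in such a way that consecutive labels add up to [N + 1], [N], [N + 2]
    cyclically.  Shifting the pattern on the edges makes the weights met along
    a cycle (vertex, edge, vertex, ...) run periodically through three values.
    The pattern is placed so that [v] carries the label [s + 12m].  The pendant
    vertices get [1 .. s], hence the pendant edges have the weights
    [N - s + 1 .. N]; the same numbers, cyclically shifted, are the labels of
    the pendant edges and so the weights of the pendant vertices.  Only the
    weights [N - s + 1 .. N + 2] and that of [v] occur. *)

Require Import Defs.
From mathcomp Require Import all_boot.
From mathcomp Require Import zify.

Set Implicit Arguments.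
Unset Strict Implicit.
Unset Printing Implicit Defensive.

(** * Degrees, the lower bound, and labelings in an arbitrary graph *)

Lemma edgesP (G : sgraph) (A : {set G}) :
  reflect (exists x y, adj x y /\ A = [set x; y]) (A \in edges G).
Proof.
rewrite inE; apply: (iffP existsP) => [[x /existsP[y /andP[xy /eqP->]]]|].
  by exists x, y.
by case=> x [y [xy ->]]; exists x; apply/existsP; exists y; rewrite xy eqxx.
Qed.

(** The map sending a neighbour [x] to the edge [[set u; x]] is a bijection onto the edges at [u];
    injectivity rests on the absence of loops. *)
Lemma degree_edges (G : sgraph) (u : G) :
  degree u = \sum_(e : edge G | u \in val e) 1.
Proof.
rewrite sum1_card /degree.
have mem x : x \in [set x | adj u x] -> [set u; x] \in edges G.
  by rewrite inE => ux; apply/edgesP; exists u, x.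
rewrite -[RHS](card_imset _ val_inj) -(card_in_imset (f := fun x => [set u; x])).
  apply: eq_card => A; apply/imsetP/imsetP => [[x ux ->]|[[B /= BE]]].
    exists (exist (fun A => A \in edges G) _ (mem _ ux)); last by [].
    exact: set21.
  rewrite -[_ \in _]/(u \in B) => uB ->; case/edgesP: BE uB => x [y [xy ->]].
  rewrite !inE => /orP[]/eqP ->; first by exists y; rewrite ?inE.
  by exists x; rewrite ?inE 1?adj_sym // setUC.
move=> x y ux uy /setP/(_ y); rewrite !inE eqxx orbT in ux uy *.
by case/orP=> /eqP // yu; rewrite yu adj_irr in uy.
Qed.

Lemma degree_lt_num_weights (G : sgraph) (u : G) (f : G + edge G -> nat) :
  local_total_antimagic f -> degree u < num_weights f.
Proof.
case=> _ _ fE fVE.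
pose W := vertex_weight f u ::
  [seq edge_weight f e | e <- enum [pred e : edge G | u \in val e]].
have -> : (degree u).+1 = size W.
  by rewrite /= size_map -cardE degree_edges sum1_card.
apply: uniq_leq_size => [|x].
  rewrite /= map_inj_in_uniq ?enum_uniq ?andbT.
    apply/mapP => -[e]; rewrite mem_enum => ue; exact: fVE.
  move=> e e'; rewrite !mem_enum !inE => ue ue' eq_w.
  case: (eqVneq e e') => // /eqP ne; case: (fE _ _ ne _ eq_w).
  by apply/set0Pn; exists u; rewrite inE; apply/andP.
rewrite mem_undup inE => /orP[/eqP->|/mapP[e _ ->]].
  exact: (codom_f (weight f) (inl u)).
exact: (codom_f (weight f) (inr e)).
Qed.

(** Surjectivity comes for free: a duplicate-free list of values inside an interval of the same size
    exhausts it. *)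
Lemma total_labeling_card (G : sgraph) (f : G + edge G -> nat) :
  injective f -> (forall x, 1 <= f x <= #|G| + #|edges G|) ->
  total_labeling f.
Proof.
move=> f_inj f_le; split=> // k; split=> [[x <-] //|k_le].
have cardT : #|{: G + edge G}| = #|G| + #|edges G| by rewrite card_sum card_sig.
have [|||_ /(_ k)] := uniq_min_size (s1 := codom f) (s2 := iota 1 (#|G| + #|edges G|)).
- by rewrite map_inj_uniq ?enum_uniq.
- by move=> _ /codomP[x ->]; rewrite mem_iota add1n ltnS.
- by rewrite size_iota size_codom cardT.
- by rewrite mem_iota add1n ltnS k_le => /codomP[x ->]; exists x.
Qed.

(** * Edges named by an explicit finite index type *)

Section EdgeIndexing.

Variables (G : sgraph) (E : finType) (ends : E -> {set G}).
Hypothesis ends_inj : injective ends.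
Hypothesis codom_ends : forall A, (A \in edges G) = (A \in codom ends).

Lemma ends_in_edges x : ends x \in edges G.
Proof. by rewrite codom_ends codom_f. Qed.

Definition indexed_edge (x : E) : edge G :=
  exist (fun A => A \in edges G) (ends x) (ends_in_edges x).

Lemma val_in_codom (e : edge G) : val e \in codom ends.
Proof. by rewrite -codom_ends (valP e). Qed.

Definition edge_index (e : edge G) : E := iinv (val_in_codom e).

Lemma ends_edge_index e : ends (edge_index e) = val e.
Proof. exact: f_iinv. Qed.

Lemma edge_indexK : cancel edge_index indexed_edge.
Proof. by move=> e; apply: val_inj; exact: ends_edge_index. Qed.

Lemma indexed_edgeK : cancel indexed_edge edge_index.
Proof. by move=> x; apply: ends_inj; rewrite f_iinv. Qed.

Lemma card_edges : #|edges G| = #|E|.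
Proof.
rewrite -card_sig; apply/eqP; rewrite eqn_leq.
by rewrite (leq_card _ (can_inj edge_indexK)) (leq_card _ (can_inj indexed_edgeK)).
Qed.

Lemma big_incident (F : edge G -> nat) (u : G) :
  \sum_(e : edge G | u \in val e) F e =
  \sum_(x | u \in ends x) F (indexed_edge x).
Proof.
rewrite (reindex indexed_edge) //; apply: onW_bij.
exact: (Bijective indexed_edgeK edge_indexK).
Qed.

(** An edge is a bare set of vertices, so its label is computed from its index, on which case
    analysis is possible. *)
Definition indexed_labeling (g : G -> nat) (h : E -> nat) (x : G + edge G) : nat :=
  match x with inl u => g u | inr e => h (edge_index e) end.

Lemma vertex_weight_indexed g h u :
  vertex_weight (indexed_labeling g h) u = \sum_(x | u \in ends x) h x.
Proof.
rewrite /vertex_weight big_incident; apply: eq_bigr => x _ /=.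
by rewrite indexed_edgeK.
Qed.

Lemma edge_weight_indexed g h e :
  edge_weight (indexed_labeling g h) e = \sum_(u in ends (edge_index e)) g u.
Proof. by rewrite /edge_weight ends_edge_index. Qed.

End EdgeIndexing.

(** * Incidences and degrees in the cycles with pendant edges *)

Section PendantCycles.

Variables (m s : nat) (v : copies m C6).

Let G := attach_pendants v s.

(** Cycles are oriented by [ordS] and a cycle edge is indexed by its tail, so vertex [i] lies on the
    edges [i] and [ord_pred i]. *)
Definition ends (x : ('I_m * 'I_6) + 'I_s) : {set G} :=
  match x with
  | inl p => [set (inl p : G); (inl (p.1, ordS p.2) : G)]
  | inr j => [set (inl v : G); (inr j : G)]
  end.

Lemma ord_pred6_neq (i : 'I_6) : (i == ord_pred (ord_pred i)) = false.
Proof. by case: i => [[|[|[|[|[|[|k]]]]]] hk]. Qed.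

Lemma mem_ends_cycle (k : 'I_m) (i : 'I_6) x : ((inl (k, i) : G) \in ends x) =
  match x with
  | inl p => (p == (k, i)) || (p == (k, ord_pred i))
  | inr _ => (k, i) == v
  end.
Proof.
case: x => [[l j]|j] /=; rewrite !inE ?orbF //.
rewrite !(inj_eq inl_inj) !xpair_eqE [k == l]eq_sym [i == j]eq_sym.
by rewrite [i == _]eq_sym (can2_eq (@ordSK 6) (@ord_predK 6)).
Qed.

Lemma mem_ends_pendant (j : 'I_s) x : ((inr j : G) \in ends x) = (x == inr j).
Proof. by case: x => [p|l] /=; rewrite !inE ?orbF //= eq_sym. Qed.

Lemma ends_inj : injective ends.
Proof.
move=> [[k i]|j] [[l i']|j'] /setP eqA.
- have := eqA (inl (k, i)); have := eqA (inl (l, i')).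
  rewrite !mem_ends_cycle !eqxx /= => /orP[/eqP[-> ->] //|/eqP[-> ei]].
  case/esym/orP=> /eqP[]; first by move=> ->.
  (* Equal edges with distinct tails would each start where the other ends, a closed walk of length
     2 along the orientation. *)
  by rewrite ei => /eqP; rewrite ord_pred6_neq.
- by have := eqA (inr j'); rewrite !mem_ends_pendant eqxx.
- by have := eqA (inr j); rewrite !mem_ends_pendant eqxx.
- by have := eqA (inr j); rewrite !mem_ends_pendant eqxx => /esym/eqP ->.
Qed.

Lemma codom_ends A : (A \in edges G) = (A \in codom ends).
Proof.
apply/edgesP/codomP => [[x [y [xy ->]]]|[[[k i]|j] ->]].
- case: x y xy => [[k i]|j] [[l i']|j'] //=.
  + case/andP=> /= /eqP<- /orP[]/eqP->.
      by exists (inl (k, i)).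
    by exists (inl (k, i')); rewrite setUC.
  + by move/eqP->; exists (inr j').
  + by move/eqP->; exists (inr j); rewrite setUC.
- exists (inl (k, i)), (inl (k, ordS i)); split=> //=.
  by rewrite /copies_adj /= eqxx /C6_adj eqxx.
- by exists (inl v), (inr j); rewrite /= eqxx.
Qed.

Lemma sum_ends_cycle (h : ('I_m * 'I_6) + 'I_s -> nat) (k : 'I_m) (i : 'I_6) :
  \sum_(x | (inl (k, i) : G) \in ends x) h x =
  h (inl (k, i)) + h (inl (k, ord_pred i)) +
  (if (k, i) == v then \sum_(j < s) h (inr j) else 0).
Proof.
rewrite (eq_bigl _ _ (mem_ends_cycle k i)) big_sumType; congr (_ + _).
  have ne : (k, ord_pred i) != (k, i).
    by rewrite xpair_eqE eqxx /=; case: (i) => [[|[|[|[|[|[|n]]]]]] hn].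
  rewrite (bigD1 (k, i)) ?eqxx //= (bigD1 (k, ord_pred i)) ?eqxx ?orbT //=.
  by rewrite big1 ?addn0 // => p; case: eqP => //=; case: eqP.
by case: ifP => _ //; rewrite big_pred0_eq.
Qed.

Lemma sum_ends_pendant (h : ('I_m * 'I_6) + 'I_s -> nat) j :
  \sum_(x | (inr j : G) \in ends x) h x = h (inr j).
Proof.
by under eq_bigl do rewrite mem_ends_pendant; rewrite big_pred1_eq.
Qed.

Lemma sum_in_ends (g : G -> nat) x :
  \sum_(u in ends x) g u =
  match x with
  | inl p => g (inl p) + g (inl (p.1, ordS p.2))
  | inr j => g (inl v) + g (inr j)
  end.
Proof.
case: x => [[k i]|j]; rewrite big_setU1 ?big_set1 // inE //.
rewrite (inj_eq inl_inj) xpair_eqE eqxx /=.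
by case: (i) => [[|[|[|[|[|[|n]]]]]] hn].
Qed.

(** A degree is the vertex weight for the constant edge label 1, so the incidence sums apply. *)
Lemma degree_attach (u : G) : degree u =
  match u with inl p => 2 + (if p == v then s else 0) | inr _ => 1 end.
Proof.
rewrite degree_edges (big_incident ends_inj codom_ends).
case: u => [[k i]|j]; last by rewrite sum_ends_pendant.
by rewrite (sum_ends_cycle (fun _ => 1)) sum1_card card_ord.
Qed.

Lemma max_degree_attach : max_degree G = s + 2.
Proof.
apply/eqP; rewrite eqn_leq; apply/andP; split.
  apply/bigmax_leqP => u _; rewrite degree_attach.
  by case: u => [p|j]; [case: ifP => _|]; lia.
by rewrite (leq_trans _ (leq_bigmax (inl v : G))) // degree_attach eqxx addnC.
Qed.

End PendantCycles.

(** * Positions relative to [v], and the label pattern on a cycle *)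

Section Positions.

Variables (m : nat) (k0 : 'I_m) (i0 : 'I_6).

(** The transposition of 0 and [k0]: together with [rotation] it moves [v] to slot 0 and position 0,
    where [cycle_label] takes its maximum. *)
Definition slot (k : 'I_m) : nat :=
  if k == k0 :> nat then 0 else if k == 0 :> nat then k0 else k.

Definition rotation (i : 'I_6) : nat := (i + (6 - i0)) %% 6.

Lemma slot_lt k : slot k < m.
Proof. by rewrite /slot; have := ltn_ord k; have := ltn_ord k0; do 2?case: ifP; lia. Qed.

Lemma slot_inj : injective slot.
Proof.
move=> k l eq_kl; apply: val_inj; move: eq_kl => /=.
by rewrite /slot; do 4?case: ifP; lia.
Qed.

Lemma rotation_lt i : rotation i < 6.
Proof. by rewrite ltn_mod. Qed.

Lemma rotation_inj : injective rotation.
Proof.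
move=> i j; rewrite /rotation => eq_ij; apply: val_inj => /=.
by have := ltn_ord i; have := ltn_ord j; have := ltn_ord i0; lia.
Qed.

Lemma rotation_ordS i : rotation (ordS i) = (rotation i).+1 %% 6.
Proof. by rewrite /rotation /=; have := ltn_ord i; have := ltn_ord i0; lia. Qed.

Lemma rotation_ord_pred i : rotation (ord_pred i) = (rotation i + 5) %% 6.
Proof. by rewrite /rotation /=; have := ltn_ord i; have := ltn_ord i0; lia. Qed.

Lemma slot_base : slot k0 = 0.
Proof. by rewrite /slot eqxx. Qed.

Lemma rotation_base : rotation i0 = 0.
Proof. by rewrite /rotation subnKC ?modnn // ltnW. Qed.

End Positions.

(* The [j]-th triple from the top and its mirror image, before the shift by [s];
   [n] stands for [12m] and [r] is the position on the cycle. *)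
Definition cycle_label (n j r : nat) : nat :=
  nth 0 [:: n - 3 * j; 3 * j + 1; n - 3 * j - 1; 3 * j + 3;
            n - 3 * j - 2; 3 * j + 2] r.

Lemma cycle_label_bounds m j r :
  j < 2 * m -> r < 6 -> 0 < cycle_label (12 * m) j r <= 12 * m.
Proof. by move=> j_lt; case: r => [|[|[|[|[|[|r]]]]]] //; rewrite /cycle_label /=; lia. Qed.

(** Even positions carry labels above [6m], odd ones labels up to [6m]; within each half the blocks
    of three consecutive integers for different [j] are disjoint. *)
Lemma cycle_label_inj m j r j' r' : j < 2 * m -> j' < 2 * m -> r < 6 -> r' < 6 ->
  cycle_label (12 * m) j r = cycle_label (12 * m) j' r' -> j = j' /\ r = r'.
Proof.
move=> j_lt j'_lt; rewrite /cycle_label.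
by case: r => [|[|[|[|[|[|r]]]]]] //; case: r' => [|[|[|[|[|[|r']]]]]] //=; lia.
Qed.

Lemma cycle_label_sum m j r : j < 2 * m -> r < 6 ->
  cycle_label (12 * m) j r + cycle_label (12 * m) j (r.+1 %% 6) =
  12 * m + (2 * r + 1) %% 3.
Proof. by move=> j_lt; case: r => [|[|[|[|[|[|r]]]]]] //; rewrite /cycle_label /=; lia. Qed.

(** * The labeling, its weights, and their comparison *)

Section Labeling.

Variables (m s : nat) (k0 : 'I_m) (i0 : 'I_6).
Hypothesis s_gt1 : 1 < s.

Let v : copies m C6 := (k0, i0).
Let G := attach_pendants v s.

Definition vertex_label (u : G) : nat :=
  match u with
  | inl p => s + cycle_label (12 * m) (slot k0 p.1) (rotation i0 p.2)
  | inr j => j.+1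
  end.

(** Vertices use the slots below [m], edges those from [m] on. With the shift by 2, the vertex at
    position [r] gets weight offset [2r] mod 3 (before any pendant contribution) and the edge
    leaving it [2r + 1], so offsets grow by 1 mod 3 at each step of vertex, edge, vertex. On pendant
    edges [ordS] separates the weight of a pendant vertex from that of its edge. *)
Definition edge_label (x : ('I_m * 'I_6) + 'I_s) : nat :=
  match x with
  | inl p => s + cycle_label (12 * m) (m + slot k0 p.1) ((rotation i0 p.2 + 2) %% 6)
  | inr j => 12 * m + s + (ordS j).+1
  end.

Definition labeling : G + edge G -> nat :=
  indexed_labeling (@codom_ends m s v) vertex_label edge_label.

Let pendant_sum := \sum_(j < s) (12 * m + s + (ordS j).+1).

(** Cycle offsets are at most 2, so this lifts the weight of [v] above all others. *)
Lemma pendant_sum_gt2 : 2 < pendant_sum.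
Proof.
have : \sum_(j < s) 2 <= pendant_sum.
  by apply: leq_sum => j _; lia.
by rewrite sum_nat_const card_ord; lia.
Qed.

Lemma vertex_weightE (u : G) : vertex_weight labeling u =
  match u with
  | inl p => 12 * m + 2 * s + (2 * rotation i0 p.2) %% 3 +
             (if p == (k0, i0) then pendant_sum else 0)
  | inr j => 12 * m + s + (ordS j).+1
  end.
Proof.
rewrite (vertex_weight_indexed (@ends_inj m s v)).
case: u => [[k i]|j]; last by rewrite sum_ends_pendant.
rewrite (@sum_ends_cycle m s v) /= -/pendant_sum; congr (_ + _).
have lt_j : m + slot k0 k < 2 * m by have := slot_lt k0 k; lia.
rewrite rotation_ord_pred; set r := rotation i0 i.
have lt_r : (r + 1) %% 6 < 6 by rewrite ltn_mod.
have := cycle_label_sum lt_j lt_r.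
(* The two cycle edges at position [r] carry the pattern entries [r + 2] and [r + 1], which are
   consecutive; [r + 5] stands for [r - 1]. *)
rewrite (_ : ((r + 1) %% 6).+1 %% 6 = (r + 2) %% 6); last by lia.
by rewrite (_ : ((r + 5) %% 6 + 2) %% 6 = (r + 1) %% 6); lia.
Qed.

Lemma edge_weightE (e : edge G) : edge_weight labeling e =
  match edge_index (@codom_ends m s v) e with
  | inl p => 12 * m + 2 * s + (2 * rotation i0 p.2 + 1) %% 3
  | inr j => 12 * m + s + j.+1
  end.
Proof.
rewrite edge_weight_indexed sum_in_ends.
case: (edge_index _ e) => [[k i]|j] /=.
  have lt_j : slot k0 k < 2 * m by have := slot_lt k0 k; lia.
  have := cycle_label_sum lt_j (rotation_lt i0 i).
  by rewrite rotation_ordS; lia.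
(* At slot 0 and position 0 the label of [v] is [s + 12m]. *)
by rewrite slot_base rotation_base /cycle_label /=; lia.
Qed.

Lemma vertex_label_cycle_bounds (p : 'I_m * 'I_6) : s < vertex_label (inl p) <= s + 12 * m.
Proof.
have lt_j : slot k0 p.1 < 2 * m by have := slot_lt k0 p.1; lia.
by have := cycle_label_bounds lt_j (rotation_lt i0 p.2); rewrite /=; lia.
Qed.

Lemma edge_label_cycle_bounds (p : 'I_m * 'I_6) : s < edge_label (inl p) <= s + 12 * m.
Proof.
have lt_j : m + slot k0 p.1 < 2 * m by have := slot_lt k0 p.1; lia.
have lt_r : (rotation i0 p.2 + 2) %% 6 < 6 by rewrite ltn_mod.
by have := cycle_label_bounds lt_j lt_r; rewrite /=; lia.
Qed.

Lemma vertex_label_inj : injective vertex_label.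
Proof.
move=> [[k i]|j] [[l i']|j'] eq_l.
- move/addnI/cycle_label_inj: eq_l; rewrite !rotation_lt.
  have := slot_lt k0 k; have := slot_lt k0 l => /= ltl ltk.
  by case=> //; try lia; move=> /slot_inj-> /rotation_inj->.
- by have := vertex_label_cycle_bounds (k, i); have := ltn_ord j'; rewrite eq_l /=; lia.
- by have := vertex_label_cycle_bounds (l, i'); have := ltn_ord j; rewrite -eq_l /=; lia.
- by congr inr; apply: val_inj; case: eq_l.
Qed.

Lemma edge_label_inj : injective edge_label.
Proof.
move=> [[k i]|j] [[l i']|j'] eq_l.
- move/addnI/cycle_label_inj: eq_l; rewrite !ltn_mod.
  have := slot_lt k0 k; have := slot_lt k0 l => /= ltl ltk.
  case=> //; try lia; move=> /addnI/slot_inj-> eq_r.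
  have lt_i := rotation_lt i0 i; have lt_i' := rotation_lt i0 i'.
  by rewrite (@rotation_inj i0 i i') //; lia.
- by have := edge_label_cycle_bounds (k, i); rewrite eq_l /=; lia.
- by have := edge_label_cycle_bounds (l, i'); rewrite -eq_l /=; lia.
- by congr inr; move/addnI: eq_l => [] eq_j; apply/(can_inj (@ordSK s))/val_inj.
Qed.

Lemma vertex_label_neq_edge_label u x : vertex_label u <> edge_label x.
Proof.
case: u x => [[k i]|j] [[l i']|j'] eq_l.
- move/addnI/cycle_label_inj: eq_l; rewrite rotation_lt ltn_mod.
  have := slot_lt k0 k; have := slot_lt k0 l => /= ltl ltk.
  by case=> //; lia.
- by have := vertex_label_cycle_bounds (k, i); rewrite eq_l /=; lia.
- by have := edge_label_cycle_bounds (l, i'); have := ltn_ord j; rewrite -eq_l /=; lia.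
- by have := ltn_ord j; move: eq_l => /=; lia.
Qed.

Lemma labeling_inj : injective labeling.
Proof.
move=> [u|e] [u'|e'] /=.
- by move/vertex_label_inj->.
- by move/vertex_label_neq_edge_label.
- by move/esym/vertex_label_neq_edge_label.
- by move/edge_label_inj/(can_inj (edge_indexK (@codom_ends m s v)))->.
Qed.

Lemma labeling_bounds x : 1 <= labeling x <= #|G| + #|edges G|.
Proof.
rewrite (card_edges (@ends_inj m s v) (@codom_ends m s v)).
rewrite !card_sum !card_prod !card_ord.
case: x => [[p|j]|e] /=.
- by have := vertex_label_cycle_bounds p; rewrite /=; lia.
- by have := ltn_ord j; lia.
case: (edge_index _ e) => [p|j].
  by have := edge_label_cycle_bounds p; move: (edge_label _) => n; lia.
by have := ltn_ord (ordS j); rewrite /edge_label; lia.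
Qed.

Lemma vertex_weight_adj (u u' : G) :
  adj u u' -> vertex_weight labeling u <> vertex_weight labeling u'.
Proof.
(* No two pendant vertices are adjacent, so by symmetry [u] lies on a cycle. *)
wlog: u u' / if u is inl _ then true else false => [th uu'|].
  case: u uu' => [p|j] uu'; first exact: th.
  case: u' uu' => [p|j'] // uu'; rewrite adj_sym in uu'.
  exact: nesym (th (inl p) (inr j) isT uu').
have S_gt2 := pendant_sum_gt2; rewrite !vertex_weightE.
case: u u' => [[k i]|j] [[l i']|j'] // _; last first.
  by move/eqP->; rewrite eqxx; have := ltn_ord (ordS j'); lia.
case/andP=> /= _ ii'; have lt_i := rotation_lt i0 i; have lt_i' := rotation_lt i0 i'.
(* Neighbouring positions differ by 1 mod 6, hence their offsets by 2 or -2 mod 3. *)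
have ne_w : (2 * rotation i0 i) %% 3 <> (2 * rotation i0 i') %% 3.
  by case/orP: ii' => /eqP->; rewrite rotation_ordS; lia.
by case: ifP; case: ifP; lia.
Qed.

Lemma edge_weight_incident (e e' : edge G) :
  e <> e' -> val e :&: val e' != set0 ->
  edge_weight labeling e <> edge_weight labeling e'.
Proof.
move=> ne_e /set0Pn[u]; rewrite inE -!(ends_edge_index (@codom_ends m s v)) !edge_weightE.
have {ne_e} : edge_index (@codom_ends m s v) e <> edge_index (@codom_ends m s v) e'.
  by move/(can_inj (edge_indexK (@codom_ends m s v))).
move: (edge_index _ e) (edge_index _ e') => x x' ne_x /andP[].
case: u => [[k i]|j]; last first.
  by rewrite !mem_ends_pendant => /eqP x_j /eqP x'_j; rewrite x_j x'_j in ne_x.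
have r_lt := rotation_lt i0 i; have r_prd := rotation_ord_pred i0 i.
have r0 := rotation_base i0.
rewrite !mem_ends_cycle.
case: x x' ne_x => [p|j] [p'|j'] ne_x.
- move=> /orP[]/eqP p_eq /orP[]/eqP p'_eq; rewrite {}p_eq {}p'_eq // in ne_x *.
    by rewrite /= r_prd; lia.
  by rewrite /= r_prd; lia.
(* The common vertex is [v], whose cycle edges sit at positions 0 and 5 and so have offsets 1 and 2:
   they exceed [12m + 2s], the largest weight of a pendant edge. *)
- have := ltn_ord j'.
  by move=> j'_lt + /eqP[_ ii0]; case/orP=> /eqP-> /=; rewrite ?r_prd ii0 r0; lia.
- have := ltn_ord j.
  by move=> j_lt /eqP[_ ii0]; case/orP=> /eqP-> /=; rewrite ?r_prd ii0 r0; lia.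
- by move=> _ _ eq_j; case: ne_x; congr inr; apply: val_inj => /=; lia.
Qed.

Lemma vertex_weight_neq_edge_weight (u : G) (e : edge G) :
  u \in val e -> vertex_weight labeling u <> edge_weight labeling e.
Proof.
rewrite -(ends_edge_index (@codom_ends m s v)) edge_weightE vertex_weightE.
move: (edge_index _ e) => x; have S_gt2 := pendant_sum_gt2.
case: u => [[k i]|j]; last first.
  (* The cyclic successor has no fixed point because [s] is at least 2. *)
  rewrite mem_ends_pendant => /eqP->; suff : (ordS j : nat) <> j by lia.
  move=> /=; have := ltn_ord j; rewrite leq_eqVlt => /orP[/eqP eq_s|lt_s].
    by rewrite eq_s modnn; lia.
  by rewrite modn_small //; lia.
have r_lt := rotation_lt i0 i; have r_prd := rotation_ord_pred i0 i.
rewrite mem_ends_cycle; case: x => [p|j]; last first.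
  by move=> ki; rewrite ki; have := ltn_ord j; lia.
by case/orP=> /eqP-> /=; rewrite ?r_prd; case: eqP => [[_ ii0]|_]; lia.
Qed.

Lemma labeling_antimagic : local_total_antimagic labeling.
Proof.
split.
- exact: total_labeling_card labeling_inj labeling_bounds.
- exact: vertex_weight_adj.
- exact: edge_weight_incident.
- exact: vertex_weight_neq_edge_weight.
Qed.

Lemma num_weights_labeling : num_weights labeling <= s + 3.
Proof.
(* The interval holds the [s] pendant weights up to [12m + 2s], the last of which is also the cycle
   weight of offset 0, and then the two cycle weights of offsets 1 and 2. *)
pose W := vertex_weight labeling (inl v : G) :: iota (12 * m + s + 1) (s + 2).
have -> : s + 3 = size W by rewrite /= size_iota addnS.
apply: uniq_leq_size (undup_uniq _) _ => w; rewrite mem_undup => /codomP[x ->].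
rewrite inE mem_iota; case: x => [u|e] /=; last first.
  rewrite edge_weightE; case: (edge_index _ e) => [p|j]; apply/orP; right; first by lia.
  by have := ltn_ord j; lia.
case: (eqVneq u (inl v)) => [-> //|ne_u]; first by rewrite eqxx.
rewrite vertex_weightE; apply/orP; right; case: u ne_u => [p|j].
  by rewrite (inj_eq inl_inj) => /negPf->; lia.
by have := ltn_ord (ordS j); lia.
Qed.

End Labeling.

Theorem corollary4p1 (m s : nat) (hm : 1 <= m) (hs : 2 <= s)
    (v : copies m C6) :
  is_chi_lt (attach_pendants v s) (max_degree (attach_pendants v s)).+1 /\
  (max_degree (attach_pendants v s)).+1 = s + 3.
Proof.
rewrite max_degree_attach -addnS; split=> //.
have lower f : local_total_antimagic f -> s + 3 <= @num_weights (attach_pendants v s) f.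
  move/(degree_lt_num_weights (inl v : attach_pendants v s)).
  by rewrite degree_attach eqxx; lia.
split=> //; case: v lower => k0 i0 lower; exists (@labeling m s k0 i0).
have anti := labeling_antimagic k0 i0 hs; split=> //.
by apply/eqP; rewrite eqn_leq lower ?num_weights_labeling.
Qed.
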